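(* Let $f$ be a differentiable objective on the Stiefel manifold $\mathcal V^{p\times k}=\{U\in\mathbb R^{p\times k}:U^TU=I_k\}$, and consider the problem $\min_{U\in\mathcal V^{p\times k}}f(U)$. Let $\mathbf R:\mathbb C^{p\times k}\to\mathbb C^{p\times k}$ be a matrix function such that for each $V\in\mathcal V^{p\times k}$ there is a real constant $\mathrm{const}(V)$ for which the function $$g(U;V)=-\operatorname{Tr}\big(\mathbf R(V)^HU\big)-\operatorname{Tr}\big(U^H\mathbf R(V)\big)+\mathrm{const}(V)$$ satisfies $g(V;V)=f(V)$ and $g(U;V)\ge f(U)$ for all $U\in\mathcal V^{p\times k}$. Fix a proximal regularization parameter $\lambda\ge0$ and, from an arbitrary $U_0\in\mathcal V^{p\times k}$, generate for $n\ge1$ $$U_n\in\operatorname*{arg\,min}_{U\in\mathcal V^{p\times k}}\big(g(U;U_{n-1})+\lambda\|U-U_{n-1}\|_F^2\big)=\operatorname*{arg\,min}_{U\in\mathcal V^{p\times k}}\big\|\mathbf R(U_{n-1})+\lambda U_{n-1}-U\big\|_F.$$ Then the iterates converge asymptotically to the set of stationary points of the problem $\min_{U\in\mathcal V^{p\times k}}f(U)$. Moreover, the iteration complexity is $N_\varepsilon=\widetilde O(\varepsilon^{-2})$.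
   Context: ${}^H$ denotes conjugate transpose and $\|\cdot\|_F$ the Frobenius norm. $\mathrm{grad} f$ is the Riemannian gradient of $f$ on $\mathcal V^{p\times k}$. A point $U$ is $\varepsilon$-stationary if $\|\mathrm{grad} f(U)\|\le\varepsilon$ and stationary if $\mathrm{grad} f(U)=0$. ''Converge asymptotically to the set of stationary points'' means every limit point of $(U_n)$ is stationary. $N_\varepsilon=\sup_{U_0\in\mathcal V^{p\times k}}\inf\{n\ge1:U_n\text{ is }\varepsilon\text{-stationary}\}$, and $\widetilde O(\cdot)$ means $O(\cdot)$ as $\varepsilon\to0^+$ up to logarithmic factors.
   Formalization: It is additionally assumed that R is bounded on the Stiefel manifold (automatic if R is continuous); for an arbitrary matrix function R both conclusions can fail, e.g. on the unit circle with f linear and R(V) = -a/2 + s(V)V, s unbounded. *)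

(* Defs.v *)
From HB Require Import structures.
From mathcomp Require Import all_boot all_order all_algebra.
From mathcomp Require Import complex.
From mathcomp Require Import all_classical all_reals all_analysis.

Set Implicit Arguments.
Unset Strict Implicit.
Unset Printing Implicit Defensive.

Import Order.TTheory GRing.Theory Num.Theory.
Import numFieldNormedType.Exports.

Local Open Scope classical_set_scope.
Local Open Scope ring_scope.
Local Open Scope sesquilinear_scope.
Local Open Scope complex_scope.

Definition argmin {d : Order.disp_t} {T : Type} {P : porderType d}
    (A : set T) (h : T -> P) : set T :=
  [set x | A x /\ forall y, A y -> (h x <= h y)%O].

(* h = Otilde(g) as e -> 0+: a big-O up to a power of log(1/e). No absolute
   value is taken on h, which is meant to be nonnegative; the value +oo is
   excluded near 0. *)
Definition soft_bigO {R : realType} (h : R -> \bar R) (g : R -> R) : Prop :=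
  exists (m : nat) (C : R),
    \forall e \near 0^'+, (h e <= (C * g e * ln e^-1 ^+ m)%:E)%E.

Section Stiefel.
Context {R : realType} {p k : nat}.
Implicit Types (U V xi G : 'M[R]_(p, k)) (f : 'M[R]_(p, k) -> R).

Definition stiefel : set 'M[R]_(p, k) := [set U | U^T *m U = 1%:M].

Definition frobenius U : R := Num.sqrt (\sum_i \sum_j U i j ^+ 2).

Definition frobeniusC (A : 'M[R[i]]_(p, k)) : R :=
  Num.sqrt (\sum_i \sum_j Normc.normc (A i j) ^+ 2).

Definition to_complex U : 'M[R[i]]_(p, k) := map_mx (real_complex R) U.

(* The tangent space at V, i.e. the kernel at V of the differential of
   U |-> U^T U. *)
Definition tangent V : set 'M[R]_(p, k) :=
  [set xi | V^T *m xi + xi^T *m V = 0].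

(* Objectives are total functions, but only their values on the Stiefel
   manifold are used: differentiability on this embedded submanifold is the
   existence, around each point, of an extension to the ambient space that is
   differentiable there. *)
Definition is_extension f V (F : 'M[R]_(p, k) -> R) : Prop :=
  differentiable F V /\ \forall U \near within stiefel (nbhs V), F U = f U.

Definition stiefel_differentiable f : Prop :=
  forall V, stiefel V -> exists F, is_extension f V F.

(* The Riemannian metric is the one induced by the Euclidean inner product
   tr(X^T Y): the gradient is the tangent vector representing the differential
   of f on the tangent space. *)
Definition is_rgrad f V G : Prop :=
  tangent V G /\
  exists2 F, is_extension f V F &
    forall xi, tangent V xi -> 'd F V xi = \tr (G^T *m xi).

Definition rgrad f V : 'M[R]_(p, k) := xget 0 [set G | is_rgrad f V G].

Definition stationary f U : Prop := stiefel U /\ rgrad f U = 0.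

Definition eps_stationary f (eps : R) U : Prop :=
  stiefel U /\ frobenius (rgrad f U) <= eps.

Section MM.
Variables (f : 'M[R]_(p, k) -> R) (Rm : 'M[R[i]]_(p, k) -> 'M[R[i]]_(p, k)).
Variables (const : 'M[R]_(p, k) -> R) (lambda : R).

(* The value is real for real U; as x <= y in R[i] means that y - x is a
   nonnegative real, the comparisons below are those of the reals. *)
Definition surrogate U V : R[i] :=
  - \tr ((Rm (to_complex V))^t* *m to_complex U)
  - \tr ((to_complex U)^t* *m Rm (to_complex V)) + (const V)%:C.

Definition majorizes : Prop :=
  forall V, stiefel V ->
    surrogate V V = (f V)%:C /\
    forall U, stiefel U -> (f U)%:C <= surrogate U V.

(* This holds in particular if Rm is continuous on the (compact) Stiefel
   manifold. It cannot be dropped: on the unit circle (p = 2, k = 1), take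
   f(U) = <a, U> with a <> 0 and Rm(V) = - a / 2 + s(V) V for an arbitrary
   s >= 0. All such Rm give majorizing surrogates, and s can be chosen to blow
   up at a nonstationary point so fast that the iterates converge to it. *)
Definition bounded_on_stiefel : Prop :=
  exists M : R, forall V, stiefel V -> frobeniusC (Rm (to_complex V)) <= M.

Definition mm_step V : set 'M[R]_(p, k) :=
  argmin stiefel
    (fun U => surrogate U V + (lambda * frobenius (U - V) ^+ 2)%:C).

Definition projection_step V : set 'M[R]_(p, k) :=
  argmin stiefel
    (fun U => frobeniusC (Rm (to_complex V) + lambda%:C *: to_complex V
                          - to_complex U)).

Definition mm_iterates : set (nat -> 'M[R]_(p, k)) :=
  [set u | stiefel (u 0%N) /\ forall n, mm_step (u n) (u n.+1)].

(* The infimum is +oo if no iterate u n with n >= 1 is eps-stationary. *)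
Definition hitting_time (eps : R) (u : nat -> 'M[R]_(p, k)) : \bar R :=
  ereal_inf [set (n%:R)%:E | n in
    [set n : nat | (1 <= n)%N /\ eps_stationary f eps (u n)]].

(* Minimizers need not be unique, so the worst case is taken over the initial
   point and over all choices of minimizers. *)
Definition iteration_complexity (eps : R) : \bar R :=
  ereal_sup [set hitting_time eps u | u in mm_iterates].

End MM.
End Stiefel.

(* Main.v *)
Require Import Defs.
From HB Require Import structures.
From mathcomp Require Import all_boot all_order all_algebra.
From mathcomp Require Import complex.
From mathcomp Require Import all_classical all_reals all_analysis.
From mathcomp Require Import ring lra.
Import Order.TTheory GRing.Theory Num.Theory.
Import numFieldNormedType.Exports.
Local Open Scope classical_set_scope.
Local Open Scope ring_scope.

Set Implicit Arguments.
Unset Strict Implicit.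

(** Write B(V) for the real part of R(V). On real matrices the surrogate is
    const(V) - 2 <B(V), U>, so majorization with equality at V says
      f(U) <= f(V) - 2 <B(V), U - V>,
    and, because <U, U> = k on the Stiefel manifold, both minimization problems
    that define a step amount to maximizing <B(V) + lambda V, U>.

    Everything else follows by testing these two facts along plane (Givens)
    rotations. The matrix W = E_ij - E_ji satisfies W^3 = - W, hence
      V(t) = V + sin t W V + (1 - cos t) W^2 V
    stays on the manifold. The tangent vectors W V span the tangent space at V,
    and a tangent vector G is an explicit function of V and of the numbers
    <G, W V> ([tangent_rotation]), so these numbers control its norm.

    First order: if f(V(t)) - f(V) <= a sin t + K (1 - cos t) for all t, then
    the differential of f at V maps W V to a ([diff_gen_of_majorant]). The
    majorant has this form, whence <grad f(V), W V> = - 2 <B(V), W V>.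

    Descent: if U is a step from V, then f(V) - f(U) is at least
    2 <B(V) + lambda V, V(t) - V> for every t. Its linear term is
    2 <B(V), W V>, as <V, W V> = 0, and its second order term is bounded
    uniformly in V since R is bounded. A suitable t gives
    <B(V), W V>^2 <= C (f(V) - f(U)), and then
    |grad f(V)|^2 <= C' (f(V) - f(U)) ([mm_succ_rgrad]).

    Complexity: boundedness of R also bounds the oscillation of f, so the
    telescoping sum of the descent estimate forces an iterate with gradient at
    most eps among the first O(eps^-2), uniformly in the initial point and
    without any logarithm.

    Limit points: grad f need not be continuous, so one cannot pass to the limit
    in grad f(u_n). The inequality f(u_n(t)) - f(u_n) <=
    - 2 sin t <B(u_n), W u_n> + K (1 - cos t), in contrast, is stable: f is
    Lipschitz on the manifold and <B(u_n), W u_n> tends to 0, so a limit point X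
    satisfies f(X(t)) - f(X) <= K (1 - cos t), and the first order fact with
    a = 0 shows that X is stationary ([limit_stationary]). *)

(** * The Frobenius inner product *)
Section FrobeniusProduct.
Context {R : realType} {p k : nat}.
Implicit Types A B C : 'M[R]_(p, k).

Definition inner A B : R := \tr (A^T *m B).

Lemma innerE A B : inner A B = \sum_i \sum_j A i j * B i j.
Proof.
rewrite /inner /mxtrace exchange_big /=; apply: eq_bigr => j _.
by rewrite mxE; apply: eq_bigr => i _; rewrite mxE.
Qed.

Lemma innerC A B : inner A B = inner B A.
Proof. by rewrite /inner -mxtrace_tr trmx_mul trmxK. Qed.

Lemma innerDr A B C : inner A (B + C) = inner A B + inner A C.
Proof. by rewrite /inner mulmxDr mxtraceD. Qed.

Lemma innerDl A B C : inner (A + B) C = inner A C + inner B C.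
Proof. by rewrite innerC innerDr !(innerC C). Qed.

Lemma innerZr a A B : inner A (a *: B) = a * inner A B.
Proof. by rewrite /inner -scalemxAr mxtraceZ. Qed.

Lemma innerZl a A B : inner (a *: A) B = a * inner A B.
Proof. by rewrite innerC innerZr innerC. Qed.

Lemma innerNr A B : inner A (- B) = - inner A B.
Proof. by rewrite -scaleN1r innerZr mulN1r. Qed.

Lemma innerBr A B C : inner A (B - C) = inner A B - inner A C.
Proof. by rewrite innerDr innerNr. Qed.

Lemma frobenius_sqr A : frobenius A ^+ 2 = inner A A.
Proof.
rewrite /frobenius sqr_sqrtr; last by do 2!apply: sumr_ge0 => ? _; exact: sqr_ge0.
by rewrite innerE; do 2!apply: eq_bigr => ? _.
Qed.

Lemma frobenius_ge0 A : 0 <= frobenius A.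
Proof. exact: sqrtr_ge0. Qed.

Lemma frobenius_entry A i j : `|A i j| <= frobenius A.
Proof.
rewrite /frobenius -sqrtr_sqr ler_wsqrtr// (bigD1 i)//= (bigD1 j)//= -addrA lerDl.
apply: addr_ge0; first by apply: sumr_ge0 => ? _; exact: sqr_ge0.
by do 2!apply: sumr_ge0 => ? _; exact: sqr_ge0.
Qed.

Lemma le_inner (a b : R) A B :
  (forall i j, `|A i j| <= a) -> (forall i j, `|B i j| <= b) ->
  `|inner A B| <= p%:R * k%:R * (a * b).
Proof.
move=> leA leB; rewrite innerE.
apply: le_trans (ler_norm_sum _ _ _) _.
rewrite -mulrA [leRHS]mulr_natl -[X in _ *+ X]card_ord -sumr_const.
apply: ler_sum => i _; apply: le_trans (ler_norm_sum _ _ _) _.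
rewrite [leRHS]mulr_natl -[X in _ *+ X]card_ord -sumr_const.
by apply: ler_sum => j _; rewrite normrM ler_pM.
Qed.

End FrobeniusProduct.

Lemma le_mulmx_entry {R : realType} {m n q : nat} (a b : R)
    (A : 'M[R]_(m, n)) (B : 'M[R]_(n, q)) :
  (forall i j, `|A i j| <= a) -> (forall i j, `|B i j| <= b) ->
  forall i j, `|(A *m B) i j| <= n%:R * (a * b).
Proof.
move=> leA leB i j; rewrite mxE; apply: le_trans (ler_norm_sum _ _ _) _.
rewrite [leRHS]mulr_natl -[X in _ *+ X]card_ord -sumr_const.
by apply: ler_sum => l _; rewrite normrM ler_pM.
Qed.

(** * Plane rotations acting on the Stiefel manifold *)
Section Givens.
Context {R : realType} {p k : nat}.
Implicit Types (V U A : 'M[R]_(p, k)) (i j : 'I_p).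

Definition skew_delta i j : 'M[R]_p := delta_mx i j - delta_mx j i.

Lemma tr_skew_delta i j : (skew_delta i j)^T = - skew_delta i j.
Proof. by rewrite /skew_delta raddfB /= !trmx_delta opprB. Qed.

Lemma skew_delta_cube i j :
  skew_delta i j *m (skew_delta i j *m skew_delta i j) = - skew_delta i j.
Proof.
have [->|nij] := eqVneq i j; first by rewrite /skew_delta subrr !mul0mx oppr0.
have -> : skew_delta i j *m skew_delta i j = - (delta_mx i i + delta_mx j j).
  rewrite /skew_delta mulmxBr !mulmxBl !mul_delta_mx_cond !eqxx (negbTE nij).
  by rewrite eq_sym (negbTE nij) !mulr0n !mulr1n sub0r subr0 -opprD addrC.
rewrite /skew_delta mulmxN mulmxDr !mulmxBl !mul_delta_mx_cond !eqxx (negbTE nij).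
by rewrite eq_sym (negbTE nij) !mulr0n !mulr1n sub0r subr0 addrC.
Qed.

(** The velocity at V of the rotations in the plane (i, j). *)
Definition gen i j V : 'M[R]_(p, k) := skew_delta i j *m V.

Lemma gen_cube i j V : gen i j (gen i j (gen i j V)) = - gen i j V.
Proof. by rewrite /gen !mulmxA -[X in X *m V]mulmxA skew_delta_cube mulNmx. Qed.

(** These inner products are the entries of the skew-symmetric matrix
    A V^T - V A^T, which determines the tangential part of A at V. *)
Lemma inner_gen i j A V : inner A (gen i j V) = (A *m V^T) i j - (A *m V^T) j i.
Proof.
have E a b : \tr (A^T *m (delta_mx a b *m V)) = (A *m V^T) a b.
  rewrite mxtrace_mulC -mulmxA mxtrace_mulC.
  rewrite /mxtrace (bigD1 b)//= big1 ?addr0 => [|l /negbTE lb].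
    rewrite mxE (bigD1 a)//= big1 ?addr0 => [|l /negbTE la].
      by rewrite [delta_mx _ _ _ _]mxE !eqxx mulr1 -[V in LHS]trmxK -trmx_mul mxE.
    by rewrite [delta_mx _ _ _ _]mxE la mulr0.
  by rewrite mxE big1// => c _; rewrite [delta_mx _ _ _ _]mxE lb andbF mulr0.
by rewrite /inner /gen mulmxBl mulmxBr raddfB /= !E.
Qed.

(** By skew-symmetry of the generator. Consequently the proximal term lambda V
    does not change first order quantities along rotations. *)
Lemma inner_gen_self i j V : inner V (gen i j V) = 0.
Proof.
rewrite inner_gen; have: (V *m V^T)^T = V *m V^T by rewrite trmx_mul trmxK.
by move/matrixP/(_ i j); rewrite mxE => ->; rewrite subrr.
Qed.

Lemma tangent_gen i j V : tangent V (gen i j V).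
Proof.
by rewrite /tangent/= /gen trmx_mul tr_skew_delta mulmxN mulNmx -mulmxA subrr.
Qed.

(** This is exp(t W) V for W the (i, j) generator: since W^3 = - W, the
    exponential series collapses to 1 + sin t W + (1 - cos t) W^2. *)
Definition givens i j (t : R) V : 'M[R]_(p, k) :=
  V + sin t *: gen i j V + (1 - cos t) *: gen i j (gen i j V).

Lemma givens0 i j V : givens i j 0 V = V.
Proof. by rewrite /givens sin0 cos0 subrr !scale0r !addr0. Qed.

(** With Y = W V and Z = W^2 V, moving W across the inner product changes its
    sign, so that W^3 = - W reduces every product to V^T Y or V^T Z. The V^T Y
    terms cancel and V^T Z gets the coefficient
    2 (1 - cos t) - sin^2 t - (1 - cos t)^2 = 0. *)
Lemma stiefel_givens i j t V : stiefel V -> stiefel (givens i j t V).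
Proof.
rewrite /stiefel/= => VV; set Y := gen i j V; set Z := gen i j Y.
have adj (C D : 'M[R]_(p, k)) : (gen i j C)^T *m D = - (C^T *m gen i j D).
  by rewrite /gen trmx_mul tr_skew_delta mulmxN mulNmx mulmxA.
have YV : Y^T *m V = - (V^T *m Y) by rewrite adj.
have YY : Y^T *m Y = - (V^T *m Z) by rewrite adj.
have ZV : Z^T *m V = V^T *m Z by rewrite adj YY opprK.
have YZ : Y^T *m Z = V^T *m Y by rewrite adj gen_cube mulmxN opprK.
have ZY : Z^T *m Y = - (V^T *m Y) by rewrite adj YZ.
have ZZ : Z^T *m Z = - (V^T *m Z) by rewrite adj gen_cube mulmxN opprK YY.
rewrite /givens -/Y -/Z !(mulmxDl, mulmxDr, linearD, linearZ) /=.
rewrite -!scalemxAl ?linearZ /= YV YY ZV YZ ZY ZZ VV.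
have := cos2Dsin2 t; set s := sin t; set c := cos t => cs.
apply/matrixP => a b; rewrite !mxE.
set y := (\sum_(_ < _) _); set z := (\sum_(_ < _) _).
set e := ((a == b)%:R).
transitivity (e + z * (1 - (c ^+ 2 + s ^+ 2))); first by ring.
by rewrite cs subrr mulr0 addr0.
Qed.

End Givens.

Section Bounds.
Context {R : realType} {p k : nat}.
Implicit Types (V U A : 'M[R]_(p, k)) (i j : 'I_p).

Lemma stiefel_entry V i (j : 'I_k) : stiefel V -> `|V i j| <= 1.
Proof.
rewrite /stiefel/= => /matrixP/(_ j j); rewrite !mxE eqxx mulr1n.
rewrite (bigD1 i)//= mxE -expr2 => VV.
rewrite -ler_sqr ?nnegrE// expr1n -normrX ger0_norm ?sqr_ge0//.
rewrite -VV lerDl.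
by apply: sumr_ge0 => l _; rewrite mxE -expr2 sqr_ge0.
Qed.

Lemma stiefel_inner V : stiefel V -> inner V V = k%:R.
Proof. by rewrite /inner => ->; rewrite mxtrace1. Qed.

Lemma stiefel_sub_entry U V i (j : 'I_k) : stiefel U -> stiefel V ->
  `|(U - V) i j| <= 2.
Proof.
move=> Us Vs; rewrite !mxE; apply: le_trans (ler_normB _ _) _.
by have := stiefel_entry i j Us; have := stiefel_entry i j Vs; lra.
Qed.

(** The rotations by pi / 2 and - pi / 2 take V to V + Y + Z and V - Y + Z, both
    with entries in [-1, 1]; Y is half their difference, and Z is half their sum
    minus V. *)
Lemma gen_entry i j V l (m : 'I_k) : stiefel V -> `|gen i j V l m| <= 1.
Proof.
move=> Vs.
have := stiefel_entry l m (stiefel_givens i j (pi / 2) Vs).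
have := stiefel_entry l m (stiefel_givens i j (- (pi / 2)) Vs).
rewrite /givens sinN cosN sin_pihalf cos_pihalf !mxE !ler_norml.
lra.
Qed.

Lemma gen_gen_entry i j V l (m : 'I_k) : stiefel V ->
  `|gen i j (gen i j V) l m| <= 2.
Proof.
move=> Vs.
have := stiefel_entry l m (stiefel_givens i j (pi / 2) Vs).
have := stiefel_entry l m (stiefel_givens i j (- (pi / 2)) Vs).
have := stiefel_entry l m Vs.
rewrite /givens sinN cosN sin_pihalf cos_pihalf !mxE !ler_norml.
lra.
Qed.

Lemma le_inner_gen_gen (a : R) A i j V : stiefel V ->
  (forall l m, `|A l m| <= a) ->
  `|inner A (gen i j (gen i j V))| <= p%:R * k%:R * (a * 2).
Proof. by move=> Vs leA; apply: le_inner => // l m; exact: gen_gen_entry. Qed.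

Lemma inner_givens i j t V A : inner A (givens i j t V) = inner A V +
  sin t * inner A (gen i j V) + (1 - cos t) * inner A (gen i j (gen i j V)).
Proof. by rewrite /givens !innerDr !innerZr. Qed.

Lemma skew_delta_entry i j l m : `|(skew_delta i j : 'M[R]_p) l m| <= 2.
Proof.
rewrite !mxE; apply: le_trans (ler_normB _ _) _.
by do 2![case: (_ && _)]; rewrite ?normr1 ?normr0; lra.
Qed.

(** A crude Lipschitz constant, uniform in the angle: a rotation is linear in
    its argument, and the entries of its generator are at most 2. *)
Lemma givens_sub_entry i j t U V (e : R) :
  (forall l m, `|(U - V) l m| <= e) ->
  forall l m, `|(givens i j t U - givens i j t V) l m| <=
    (1 + p%:R * 2 + 2 * (p%:R * (2 * (p%:R * 2)))) * e.
Proof.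
move=> le_e l m.
have -> : givens i j t U - givens i j t V = givens i j t (U - V).
  rewrite /givens /gen !mulmxBr !scalerBr.
  by rewrite !opprD !addrA; apply/matrixP => a b; rewrite !mxE; ring.
have H1 := le_mulmx_entry (skew_delta_entry i j) le_e.
have H2 := le_mulmx_entry (skew_delta_entry i j) H1.
move: (le_e l m) (H1 l m) (H2 l m); rewrite /givens /gen !mxE.
set y := (\sum_(_ < _) _); set z := (\sum_(_ < _) _).
set u := U l m - V l m.
have := sin_max t; rewrite ler_norml => /andP[s1 s2].
have := cos_max t; rewrite ler_norml => /andP[c1 c2].
move=> ue ye ze.
apply: le_trans (ler_normD _ _) _.
apply: (@le_trans _ _ (`|u| + `|sin t * y| + `|(1 - cos t) * z|)).
  by rewrite lerD2r ler_normD.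
have -> : (1 + p%:R * 2 + 2 * (p%:R * (2 * (p%:R * 2)))) * e =
    e + p%:R * (2 * e) + 2 * (p%:R * (2 * (p%:R * (2 * e)))) by ring.
apply: lerD; first apply: lerD => //.
  by rewrite normrM (le_trans _ ye)// ler_piMl// sin_max.
rewrite normrM ler_pM// ger0_norm; lra.
Qed.

(** The manifold is closed; entrywise, X^T X - 1 equals
    (X - U)^T X + U^T (X - U) for U on the manifold. *)
Lemma stiefel_limit (X : 'M[R]_(p, k)) :
  (forall e : R, 0 < e ->
    exists2 U, stiefel U & forall l m, `|(X - U) l m| <= e) ->
  stiefel X.
Proof.
move=> HX; rewrite /stiefel/=; apply/matrixP => a b; apply/eqP.
rewrite -subr_eq0 -normr_le0; apply/ler_addgt0Pr => e e0; rewrite add0r.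
pose d : R := Num.min 1 (e / (3 * p%:R + 1)).
have c0 : 0 < 3 * p%:R + 1 :> R by rewrite ltr_wpDl// mulr_ge0.
have d0 : 0 < d by rewrite lt_min ltr01 divr_gt0.
have [U Us XU] := HX _ d0.
have leU (i : 'I_p) (j : 'I_k) : `|U i j| <= 1 by exact: stiefel_entry.
have leX (i : 'I_p) (j : 'I_k) : `|X i j| <= 2.
  have -> : X i j = (X - U) i j + U i j by rewrite !mxE subrK.
  apply: le_trans (ler_normD _ _) _.
  have : d <= 1 by rewrite ge_min lexx.
  by have := XU i j; have := leU i j; lra.
have leUT (j : 'I_k) (i : 'I_p) : `|U^T j i| <= 1 by rewrite mxE.
have leXUT (j : 'I_k) (i : 'I_p) : `|(X - U)^T j i| <= d.
  by rewrite [X in `|X|]mxE.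
have := le_mulmx_entry leXUT leX a b; have := le_mulmx_entry leUT XU a b.
have -> : (X^T *m X) a b - 1%:M a b =
    ((X - U)^T *m X) a b + (U^T *m (X - U)) a b.
  transitivity (((X - U)^T *m X + U^T *m (X - U)) a b); last by rewrite mxE.
  rewrite linearB /= mulmxBl mulmxBr addrA subrK.
  by have -> : U^T *m U = 1%:M := Us; rewrite !mxE.
move=> H1 H2; apply: le_trans (ler_normD _ _) _.
have : d * (3 * p%:R + 1) <= e by rewrite -ler_pdivlMr// ge_min lexx orbT.
by lra.
Qed.

End Bounds.

(** * Tangent vectors and the Riemannian gradient *)
Section Tangent.
Context {R : realType} {p k : nat}.
Implicit Types (V G : 'M[R]_(p, k)).

Lemma half_add (m n : nat) (X : 'M[R]_(m, n)) : 2^-1 *: (X + X) = X.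
Proof.
by rewrite scalerDr -scalerDl (_ : 2^-1 + 2^-1 = 1) ?scale1r//; lra.
Qed.

(** The orthogonal projection of G onto the tangent space at V, written through
    the skew-symmetric matrix S = G V^T - V G^T; it fixes the tangent vector G.
    As the entries of S are the inner products of G with the generators, these
    finitely many numbers determine G. *)
Lemma tangent_rotation V G : stiefel V -> tangent V G ->
  let S := G *m V^T - V *m G^T in
  G = S *m V - 2^-1 *: (V *m (V^T *m (S *m V))).
Proof.
rewrite /stiefel /tangent /= => VV tG.
have -> : (G *m V^T - V *m G^T) *m V = G - V *m (G^T *m V).
  by rewrite mulmxBl -!mulmxA VV mulmx1.
have -> : V^T *m (G - V *m (G^T *m V)) = - (G^T *m V) - G^T *m V.
  rewrite mulmxBr !mulmxA VV mul1mx; congr (_ - _).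
  by apply/eqP; rewrite -addr_eq0; apply/eqP.
by rewrite -opprD mulmxN mulmxDr scalerN half_add opprK subrK.
Qed.

(** In [tangent_rotation], if the entries of S are at most e and those of V at
    most 1, the entries of G are at most (p + k p^2) e; there are p k of them. *)
Definition grad_cst : R :=
  p%:R * k%:R * (p%:R + k%:R * (p%:R * p%:R)) ^+ 2.

Lemma grad_cst_ge0 : 0 <= grad_cst.
Proof. by rewrite /grad_cst !mulr_ge0 ?sqr_ge0 ?ler0n. Qed.

Lemma frobenius_tangent_le V G (x : R) : stiefel V -> tangent V G -> 0 <= x ->
  (forall i j, inner G (gen i j V) ^+ 2 <= x) ->
  frobenius G ^+ 2 <= grad_cst * x.
Proof.
move=> Vs tG x0 Hx; set e := Num.sqrt x.
have e0 : 0 <= e by exact: sqrtr_ge0.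
set S := G *m V^T - V *m G^T.
have leS (i j : 'I_p) : `|S i j| <= e.
  rewrite -(@ler_sqr _ `|S i j|) ?nnegrE// /e sqr_sqrtr// real_normK ?num_real//.
  suff -> : S i j = inner G (gen i j V) by exact: Hx.
  by rewrite inner_gen /S -[V *m G^T]trmxK trmx_mul trmxK !mxE.
have leV i (j : 'I_k) : `|V i j| <= 1 by exact: stiefel_entry.
have leVT (j : 'I_k) i : `|V^T j i| <= 1 by rewrite mxE.
have leSV := le_mulmx_entry leS leV.
have leVSV := le_mulmx_entry leV (le_mulmx_entry leVT leSV).
have leG i (j : 'I_k) : `|G i j| <= (p%:R + k%:R * (p%:R * p%:R)) * e.
  rewrite (tangent_rotation Vs tG) -/S mxE.
  apply: le_trans (ler_normD _ _) _; rewrite [in X in _ + X]mxE normrN.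
  rewrite [in X in _ + X]mxE normrM.
  rewrite mulrDl; apply: lerD; first by rewrite (le_trans (leSV _ _))// mulr1.
  rewrite ger0_norm ?invr_ge0//.
  apply: (@le_trans _ _ (1 * `|(V *m (V^T *m (S *m V))) i j|)).
    by rewrite ler_wpM2r// invf_le1// ler1n.
  rewrite mul1r; apply: le_trans (leVSV _ _) _.
  by rewrite !mul1r mulr1 !mulrA.
rewrite frobenius_sqr; apply: le_trans (ler_norm _) _.
apply: le_trans (le_inner leG leG) _.
have -> : x = e ^+ 2 by rewrite /e sqr_sqrtr.
by rewrite /grad_cst -!mulrA; lra.
Qed.

End Tangent.

Section Gradient.
Context {R : realType} {p k : nat}.
Implicit Types (V U A : 'M[R]_(p, k)) (i j : 'I_p).

Lemma linear_inner (L : {linear 'M[R]_(p, k) -> R}) :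
  exists D, forall X, L X = inner D X.
Proof.
exists (\matrix_(i, j) L (delta_mx i j)) => X.
rewrite innerE {1}(matrix_sum_delta X) linear_sum; apply: eq_bigr => i _.
rewrite linear_sum; apply: eq_bigr => j _.
by rewrite linearZ mxE /= mulrC.
Qed.

(** The gradient exists: project onto the tangent space at V the vector D that
    represents the ambient differential of an extension. The removed component
    is V N / 2 with N symmetric, which is orthogonal to every tangent xi because
    V^T xi is skew-symmetric. *)
Lemma is_rgrad_rgrad (f : 'M[R]_(p, k) -> R) V :
  stiefel_differentiable f -> stiefel V -> is_rgrad f V (rgrad f V).
Proof.
move=> fdiff Vs; have [F FV] := fdiff _ Vs.
have [D DE] := linear_inner ('d F V).
apply: xgetPex; set N := V^T *m D + D^T *m V.
have NT : N^T = N by rewrite /N raddfD/= !trmx_mul !trmxK addrC.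
have VV : V^T *m V = 1%:M := Vs.
exists (D - 2^-1 *: (V *m N)); split.
  set G := D - _; have VG : V^T *m G = V^T *m D - 2^-1 *: N.
    by rewrite /G mulmxBr -scalemxAr mulmxA VV mul1mx.
  have -> : tangent V G = (V^T *m G + (V^T *m G)^T = 0).
    by rewrite trmx_mul trmxK.
  rewrite VG [(_ - _)^T]linearB /= [(2^-1 *: _)^T]linearZ /= NT trmx_mul trmxK.
  by rewrite addrACA -/N -opprD -scalerDr half_add subrr.
exists F => // xi txi; rewrite DE -/(inner _ _) [RHS]innerC innerBr innerZr.
rewrite [LHS]innerC; suff -> : inner xi (V *m N) = 0 by rewrite mulr0 subr0.
rewrite innerC /inner trmx_mul NT -mulmxA.
set M := V^T *m xi.
have MT : M^T = - M.
  by apply/eqP; rewrite -addr_eq0 /M trmx_mul trmxK addrC; apply/eqP.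
have : \tr (N *m M) = - \tr (N *m M).
  by rewrite -{1}mxtrace_tr trmx_mul NT MT mulNmx raddfN/= mxtrace_mulC.
by move=> ?; lra.
Qed.

(** Fermat's rule with differentiability at the single point x, which is all
    that differentiability at a point of the manifold provides. *)
Lemma derive_local_max (h : R -> R) (x D : R) :
  is_derive x 1 h D -> (\forall t \near x, h t <= h x) -> D = 0.
Proof.
move=> [hx Dx] hmax; move: hx; rewrite /derivable => hx.
have {}hx : (fun e : R => e^-1 *: (h (e + x) - h x)) @ 0^' --> D.
  rewrite -Dx /derive.
  have -> : (fun e : R => e^-1 *: (h (e + x) - h x)) =
      (fun e : R => e^-1 *: ((h \o shift x) (e *: 1) - h x)).
    by apply/funext => e /=; rewrite [e *: 1]mulr1.
  exact: hx.
have hmax0 : \forall e \near (0 : R), h (e + x) <= h x.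
  have : (fun e : R => e + x) @ (0 : R) --> x.
    by rewrite -{2}[x]add0r; apply: cvgD; [exact: cvg_id|exact: cvg_cst].
  by move=> /(_ _ hmax).
apply/eqP; rewrite eq_le; apply/andP; split.
- apply: (closed_cvg (fun y : R => y <= 0) _ _ _ (cvg_dnbhs_at_right hx)).
  + exact: closed_le.
  + near=> e; apply: mulr_ge0_le0; first by rewrite invr_ge0.
    by rewrite subr_le0; near: e; apply: cvg_within.
- apply: (closed_cvg (fun y : R => 0 <= y) _ _ _ (cvg_dnbhs_at_left hx)).
  + exact: closed_ge.
  + near=> e; apply: mulr_le0; first by rewrite invr_le0.
    by rewrite subr_le0; near: e; apply: cvg_within.
Unshelve. all: by end_near. Qed.

Lemma is_derive_scalel (h : R -> R) (D x : R) (Y : 'M[R]_(p, k)) :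
  is_derive x 1 h D -> is_derive x 1 (fun t => h t *: Y) (D *: Y).
Proof.
move=> [hx Dx]; have dh : differentiable h x by apply/derivable1_diffP.
have dY := differentiableZl Y dh; split; first exact: diff_derivable.
rewrite deriveE//; have /(congr1 (fun g => g 1)) E := diffZl Y dh.
apply: etrans; first exact: E.
by rewrite /= -deriveE// Dx.
Qed.

Lemma is_derive_givens (V : 'M[R]_(p, k)) i j :
  is_derive (0 : R) 1 (fun t => givens i j t V) (gen i j V).
Proof.
have ds : is_derive (0 : R) 1 (@sin R) 1 by apply: is_derive_eq; rewrite cos0.
have dc : is_derive (0 : R) 1 (fun t : R => 1 - cos t) 0.
  by apply: is_derive_eq; rewrite sin0 !oppr0 mulr0.
have d1 := is_derive_scalel (gen i j V) ds.
have d2 := is_derive_scalel (gen i j (gen i j V)) dc.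
have d0 : is_derive (0 : R) 1 (fun _ : R => V) 0 by exact: is_derive_cst.
have := is_deriveD (is_deriveD d0 d1) d2.
by rewrite add0r scale1r scale0r addr0.
Qed.

(** The difference between f along the rotation and the right-hand side has a
    maximum at t = 0, and 1 - cos t does not contribute to its derivative
    there. *)
Lemma diff_gen_of_majorant f F V i j (a K : R) :
  stiefel V -> is_extension f V F ->
  (forall t, f (givens i j t V) - f V <= sin t * a + (1 - cos t) * K) ->
  'd F V (gen i j V) = a.
Proof.
move=> Vs [dF fF] Hf; have gV := is_derive_givens V i j.
set g := fun t : R => givens i j t V in gV.
have dg : differentiable g (0 : R) by apply/derivable1_diffP.
have dF' : differentiable F (g 0) by rewrite /g givens0.
pose h t := (F \o g) t - (sin t * a + (1 - cos t) * K).
have hD : is_derive (0 : R) 1 h ('d F V (gen i j V) - a).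
  have D1 : is_derive (0 : R) 1 (F \o g) ('d F V (gen i j V)).
    have dFg := differentiable_comp dg dF'.
    split; first exact: diff_derivable.
    rewrite deriveE//; apply: etrans.
      exact: (congr1 (fun h => h 1) (diff_comp dg dF')).
    have g1 : 'd g (0 : R) 1 = gen i j V.
      by have := deriveE (1 : R) dg; rewrite derive_val.
    have E : 'd F (g 0) ('d g (0 : R) 1) = 'd F (g 0) (gen i j V).
      exact: (congr1 (fun y => 'd F (g 0) y) g1).
    by apply: etrans E _; rewrite /g givens0.
  have D2 : is_derive (0 : R) 1 (fun t => sin t * a + (1 - cos t) * K) a.
    apply: is_derive_eq.
    rewrite /GRing.scale/= sin0 cos0; ring.
  exact: is_deriveB.
apply/eqP; rewrite -subr_eq0; apply/eqP; apply: (derive_local_max hD).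
have gc : g @ (0 : R) --> V.
  have <- : g 0 = V by exact: givens0.
  exact: differentiable_continuous dg.
have /gc : nbhs V [set U | stiefel U -> F U = f U] by exact: fF.
have FV : F V = f V by apply: (nbhs_singleton fF).
move=> /= near_g; rewrite /h /= /g givens0 FV sin0 cos0 subrr !mul0r addr0 subr0.
near=> t.
have -> : F (givens i j t V) = f (givens i j t V).
  have : stiefel (g t) -> F (g t) = f (g t) by near: t.
  by apply; exact: stiefel_givens.
by have := Hf t; lra.
Unshelve. all: by end_near. Qed.

End Gradient.

(** * Majorization and descent *)
(** Take sin t = s with s = a / (2 K) and cos t >= 0: then 1 - cos t <= s^2, so
    the left-hand side is at least s a - K s^2 = a^2 / (4 K). *)
Lemma givens_gain (R : realType) (a q d K : R) : 0 < K -> `|a| <= K -> `|q| <= K ->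
  (forall t, sin t * a + (1 - cos t) * q <= d) -> a ^+ 2 <= 4 * K * d.
Proof.
move=> K0 aK qK /(_ (asin (a / (2 * K)))).
set s := a / (2 * K).
have aE : a = 2 * K * s by rewrite /s mulrC divfK// mulf_neq0// gt_eqF.
have sle : -1 <= s <= 1.
  by move: aK; rewrite aE ler_norml; nra.
have s1 : 0 <= 1 - s ^+ 2 by nra.
rewrite asinK; last by rewrite in_itv.
rewrite cos_asin//; set c := Num.sqrt _ => H.
have c0 : 0 <= c by exact: sqrtr_ge0.
have cc : c ^+ 2 = 1 - s ^+ 2 by rewrite sqr_sqrtr.
have c1 : c <= 1 by nra.
have cs : 1 - c <= s ^+ 2 by nra.
have : - (s ^+ 2 * K) <= (1 - c) * q.
  by move: qK; rewrite ler_norml => /andP[? ?]; nra.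
rewrite aE in H * => H2.
have : s * (2 * K * s) - s ^+ 2 * K <= d by lra.
nra.
Qed.

(** Here B is any selection of linear majorants of f on the manifold, bounded
    entrywise by M; it will be the real part of R. *)
Section LinearMajorant.
Context {R : realType} {p k : nat}.
Context (f : 'M[R]_(p, k) -> R) (B : 'M[R]_(p, k) -> 'M[R]_(p, k)).
Context (lambda M : R).
Implicit Types U V X Y : 'M[R]_(p, k).

Context (fdiff : stiefel_differentiable f).
Context (majB : forall V U, stiefel V -> stiefel U ->
  f U <= f V - 2 * inner (B V) (U - V)).
Context (leB : forall V i (j : 'I_k), stiefel V -> `|B V i j| <= M).
Context (lambda_ge0 : 0 <= lambda) (M_ge0 : 0 <= M).

Lemma inner_rgrad_of_majorant V i j (a K : R) : stiefel V ->
  (forall t, f (givens i j t V) - f V <= sin t * a + (1 - cos t) * K) ->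
  inner (rgrad f V) (gen i j V) = a.
Proof.
move=> Vs Hf; have [_ [F FV dF]] := is_rgrad_rgrad fdiff Vs.
rewrite -(diff_gen_of_majorant Vs FV Hf).
by apply: etrans (esym (dF _ (tangent_gen i j V))).
Qed.

Lemma majB_givens V i j t : stiefel V ->
  f (givens i j t V) - f V <= sin t * (- 2 * inner (B V) (gen i j V)) +
    (1 - cos t) * (- 2 * inner (B V) (gen i j (gen i j V))).
Proof.
move=> Vs; have := majB Vs (stiefel_givens i j t Vs).
by rewrite innerBr inner_givens; lra.
Qed.

Lemma inner_rgrad V i j : stiefel V ->
  inner (rgrad f V) (gen i j V) = - 2 * inner (B V) (gen i j V).
Proof. by move=> Vs; apply: inner_rgrad_of_majorant => // t; exact: majB_givens. Qed.

Lemma f_lipschitz U V (r : R) : stiefel U -> stiefel V ->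
  (forall i j, `|(U - V) i j| <= r) ->
  f U - f V <= 2 * (p%:R * k%:R * (M * r)).
Proof.
move=> Us Vs ler; have := majB Vs Us.
have := le_inner (fun i j => leB i j Vs) ler; rewrite ler_norml => /andP[+ _].
lra.
Qed.

(** The form common to the two minimization problems of a step from V: both
    objectives are decreasing functions of this inner product. *)
Definition mm_succ V U : Prop := [/\ stiefel V, stiefel U &
  forall Y, stiefel Y ->
    inner (B V + lambda *: V) Y <= inner (B V + lambda *: V) U].

Lemma mm_succ_decrease V U Y : mm_succ V U -> stiefel Y ->
  2 * inner (B V + lambda *: V) (Y - V) <= f V - f U.
Proof.
move=> [Vs Us opt] Ys; have := majB Vs Us; have := opt _ Ys.
rewrite !innerBr !innerDl !innerZl (stiefel_inner Vs).
(* The proximal term helps: <V, U> <= k on the manifold. *)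
have : 0 <= inner (U - V) (U - V) by rewrite -frobenius_sqr sqr_ge0.
rewrite innerBr ![inner (U - V) _]innerC !innerBr.
rewrite (innerC U V) (stiefel_inner Us) (stiefel_inner Vs) => UV.
have : 0 <= lambda * (k%:R - inner V U) by apply: mulr_ge0 => //; lra.
lra.
Qed.

Lemma mm_succ_le V U : mm_succ V U -> f U <= f V.
Proof.
move=> VU; have [Vs _ _] := VU; have := mm_succ_decrease VU Vs.
by rewrite subrr innerC /inner trmx0 mul0mx mxtrace0 mulr0 subr_ge0.
Qed.

(** A common bound for the first and second order coefficients, along all
    rotations, of the linear functional maximized by a step; the summand 1 keeps
    it positive. *)
Definition curvature : R := p%:R * k%:R * ((M + lambda) * 2) + 1.

Lemma curvature_gt0 : 0 < curvature.
Proof. by rewrite /curvature ltr_wpDl// !mulr_ge0// addr_ge0. Qed.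

(** The rotations of V compete with U in the maximization defining the step, so
    [givens_gain] applies to the decrease (f V - f U) / 2. *)
Lemma mm_succ_gen V U i j : mm_succ V U ->
  inner (B V) (gen i j V) ^+ 2 <= 2 * curvature * (f V - f U).
Proof.
move=> VU; have [Vs Us _] := VU.
have pk0 : 0 <= p%:R * k%:R :> R by rewrite mulr_ge0.
have le1 := le_inner (fun l m => leB l m Vs) (fun l m => gen_entry i j l m Vs).
have le2 : `|inner (B V + lambda *: V) (gen i j (gen i j V))| <= curvature.
  apply: (@le_trans _ _ (p%:R * k%:R * ((M + lambda) * 2))); last first.
    by rewrite /curvature lerDl.
  apply: le_inner_gen_gen => // l m; rewrite !mxE.
  apply: le_trans (ler_normD _ _) _; apply: lerD; first exact: leB.
  by rewrite normrM (ger0_norm lambda_ge0) ler_piMr// stiefel_entry.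
have -> : 2 * curvature * (f V - f U) = 4 * curvature * ((f V - f U) / 2).
  by field.
apply: (givens_gain curvature_gt0 _ le2) => [|t].
  apply: le_trans le1 _; rewrite /curvature mulr1.
  have : p%:R * k%:R * M <= p%:R * k%:R * ((M + lambda) * 2).
    by rewrite ler_wpM2l//; have := lambda_ge0; have := M_ge0; lra.
  lra.
have := mm_succ_decrease VU (stiefel_givens i j t Vs).
rewrite innerBr inner_givens [X in sin t * X]innerDl innerZl inner_gen_self.
lra.
Qed.

(** The factor 8 is 4 * 2: the gradient pairs with the generators as - 2 B(V). *)
Definition descent_cst : R := @grad_cst R p k * (8 * curvature).

Lemma mm_succ_rgrad V U : mm_succ V U ->
  frobenius (rgrad f V) ^+ 2 <= descent_cst * (f V - f U).
Proof.
move=> VU; have [Vs Us _] := VU.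
have cv0 := ltW curvature_gt0.
rewrite /descent_cst -[leRHS]mulrA; apply: (frobenius_tangent_le Vs).
- by have [] := is_rgrad_rgrad fdiff Vs.
- by rewrite !mulr_ge0// subr_ge0 mm_succ_le.
move=> i j; rewrite inner_rgrad//.
have := mm_succ_gen i j VU; lra.
Qed.

Lemma f_osc U V : stiefel U -> stiefel V ->
  f U - f V <= 2 * (p%:R * k%:R * (M * 2)).
Proof. by move=> Us Vs; apply: f_lipschitz => // i j; exact: stiefel_sub_entry. Qed.

(** * Limit points and complexity *)
(** The gradient of f may be discontinuous, so the limit is taken in the bound
    of f along a rotation. Its first order coefficient vanishes in the limit,
    while K bounds the second order coefficient at all V; the result is a
    majorant of f along the rotations of X with zero slope. *)
Lemma limit_stationary X :
  (forall e, 0 < e -> exists2 V, stiefel V &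
    (forall i j, `|(X - V) i j| <= e) /\
    forall i j, `|inner (B V) (gen i j V)| <= e) ->
  stationary f X.
Proof.
move=> HX; have Xs : stiefel X.
  by apply: stiefel_limit => e /HX[V Vs [XV _]]; exists V.
split=> //.
pose K : R := 2 * (p%:R * k%:R * (M * 2)).
pose L : R := 1 + p%:R * 2 + 2 * (p%:R * (2 * (p%:R * 2))).
have L0 : 0 <= L by rewrite /L !addr_ge0 ?mulr_ge0// ?mulr_ge0// ?mulr_ge0.
have pk0 : 0 <= p%:R * k%:R :> R by rewrite mulr_ge0.
have touch i j t : f (givens i j t X) - f X <= sin t * 0 + (1 - cos t) * K.
  rewrite mulr0 add0r; apply/ler_addgt0Pr => e e0.
  (* Moving from X to V costs 2 p k M L d on the rotated points and 2 p k M d on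
     the points themselves; the first order term costs 2 d. *)
  pose C : R := 2 * (p%:R * k%:R * (M * L)) + 2 * (p%:R * k%:R * M) + 2 + 1.
  have C0 : 0 < C.
    by rewrite /C ltr_wpDl// !addr_ge0// !mulr_ge0// !mulr_ge0.
  have eC0 : 0 < e / C by rewrite divr_gt0.
  have [V Vs [XV BV]] := HX _ eC0.
  have eE : e = C * (e / C) by rewrite mulrC divfK// gt_eqF.
  move: eC0 XV BV eE; set d := e / C => d0 XV BV ->.
  have VX l m : `|(V - X) l m| <= d.
    by have := XV l m; rewrite !mxE distrC.
  have H1 := f_lipschitz (stiefel_givens i j t Xs) (stiefel_givens i j t Vs)
    (givens_sub_entry i j t XV).
  have H2 := f_lipschitz Vs Xs VX.
  have H3 := majB_givens i j t Vs.
  have H4 : sin t * (- 2 * inner (B V) (gen i j V)) <= 2 * d.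
    apply: le_trans (ler_norm _) _; rewrite !normrM normrN normr_nat.
    rewrite mulrCA ler_wpM2l// (le_trans _ (BV i j))// ler_piMl//.
    exact: sin_max.
  have H5 : (1 - cos t) * (- 2 * inner (B V) (gen i j (gen i j V))) <=
      (1 - cos t) * K.
    apply: ler_wpM2l; first by rewrite subr_ge0 cos_le1.
    have := le_inner_gen_gen i j Vs (fun l m => leB l m Vs).
    by rewrite ler_norml /K => /andP[+ _]; lra.
  rewrite -/L in H1.
  have -> : C * d = 2 * (p%:R * k%:R * (M * (L * d))) +
    2 * (p%:R * k%:R * (M * d)) + 2 * d + d by rewrite /C; ring.
  lra.
have grad0 i j : inner (rgrad f X) (gen i j X) ^+ 2 <= 0.
  by rewrite (inner_rgrad_of_majorant Xs (touch i j)) expr0n.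
have [tG _] := is_rgrad_rgrad fdiff Xs.
have := frobenius_tangent_le Xs tG (lexx 0) grad0; rewrite mulr0 => G0.
apply/matrixP => i j; apply/eqP; rewrite mxE -normr_le0.
apply: le_trans (frobenius_entry _ _ _) _.
by rewrite le_eqVlt -sqrf_eq0 eq_le G0 sqr_ge0.
Qed.

Definition mm_sequence (u : nat -> 'M[R]_(p, k)) : Prop :=
  forall n, mm_succ (u n) (u n.+1).

Lemma mm_decrease_small u (e : R) : mm_sequence u -> 0 < e ->
  \forall n \near \oo, f (u n) - f (u n.+1) <= e.
Proof.
move=> Hu e0.
have us n : stiefel (u n) by have [] := Hu n.
have dec : nonincreasing_seq (f \o u).
  by apply/nonincreasing_seqP => n /=; exact: mm_succ_le.
have bnd : has_lbound (range (f \o u)).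
  exists (f (u 0%N) - 2 * (p%:R * k%:R * (M * 2))) => _ [n _ <-] /=.
  by have := f_osc (us 0%N) (us n); lra.
have cv := nonincreasing_is_cvgn dec bnd.
have cvS : (fun n => (f \o u) n.+1) @ \oo --> limn (f \o u).
  by rewrite (cvg_shiftS (f \o u)).
have := cvgB cv cvS; rewrite subrr => cv0; exact: cvgr_le (cv0 _) _ e0.
Qed.

Lemma cluster_stationary u X : mm_sequence u ->
  cluster (u @ \oo) X -> stationary f X.
Proof.
move=> Hu clX; apply: limit_stationary => e e0.
have us n : stiefel (u n) by have [] := Hu n.
have cv0 := curvature_gt0.
have d0 : 0 < e ^+ 2 / (2 * curvature) by rewrite divr_gt0 ?exprn_gt0 ?mulr_gt0.
have near_dec := mm_decrease_small Hu d0.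
pose P := [set V | stiefel V /\ forall i j, `|inner (B V) (gen i j V)| <= e].
have uP : (u @ \oo) P.
  rewrite /= /P; near=> n; split=> // i j.
  rewrite -ler_sqr ?nnegrE//; last exact: ltW.
  rewrite real_normK ?num_real//; apply: le_trans (mm_succ_gen i j (Hu n)) _.
  have -> : e ^+ 2 = 2 * curvature * (e ^+ 2 / (2 * curvature)).
    by rewrite mulrC divfK// gt_eqF// mulr_gt0.
  rewrite ler_wpM2l//; last by near: n.
  by rewrite mulr_ge0// ltW.
have [V [[Vs BV] XV]] := clX _ _ uP (nbhsx_ballx X e e0).
exists V => //; split=> // i j.
have [_ /(_ i j) XVij] := XV; rewrite !mxE; exact: ltW XVij.
Unshelve. all: by end_near. Qed.

(** If the first N iterates had gradients larger than e, summing the descent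
    estimate over them would give N e^2 <= c D, where D bounds the oscillation
    of f; N is the first integer above c D / e^2. *)
Lemma complexity_bound u (e : R) : mm_sequence u -> 0 < e ->
  (hitting_time f e u <=
    (descent_cst * (2 * (p%:R * k%:R * (M * 2))) * e ^- 2 + 1)%:E)%E.
Proof.
move=> Hu e0; set D := 2 * _; set c := descent_cst.
have us n : stiefel (u n) by have [] := Hu n.
pose N := (Num.truncn (c * D * e ^- 2)).+1.
have e2 : 0 < e ^+ 2 by rewrite exprn_gt0.
have cv0 := ltW curvature_gt0.
have c0 : 0 <= c by rewrite /c /descent_cst !mulr_ge0 ?grad_cst_ge0.
have D0 : 0 <= D by rewrite /D !mulr_ge0.
have cD0 : 0 <= c * D * e ^- 2 by rewrite !mulr_ge0// invr_ge0 ltW.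
have [n [n1 nN small]] : exists n, [/\ (1 <= n)%N, (n <= N)%N &
    frobenius (rgrad f (u n)) <= e].
  apply: contrapT => Hno.
  have big n : (1 <= n)%N -> (n <= N)%N ->
      e ^+ 2 <= c * (f (u n) - f (u n.+1)).
    move=> n1 nN; apply: le_trans (mm_succ_rgrad (Hu n)).
    rewrite ler_sqr ?nnegrE ?frobenius_ge0 ?ltW// ltNge; apply/negP => small.
    by apply: Hno; exists n.
  have sum n : (n <= N)%N -> n%:R * e ^+ 2 <= c * (f (u 1%N) - f (u n.+1)).
    elim: n => [|n IHn] nN; first by rewrite mul0r subrr mulr0.
    have := IHn (ltnW nN); have := big n.+1 isT nN.
    by rewrite -[in n.+1%:R]natr1; lra.
  have := sum N (leqnn _).
  have : c * (f (u 1%N) - f (u N.+1)) <= c * D by rewrite ler_wpM2l// f_osc.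
  have : c * D < N%:R * e ^+ 2.
    by rewrite -ltr_pdivrMr//; exact: truncnS_gt.
  lra.
apply: ereal_inf_le; exists n%:R%:E; first by exists n.
rewrite lee_fin; apply: (@le_trans _ _ N%:R); first by rewrite ler_nat.
by rewrite /N -natr1 lerD2r truncn_le.
Qed.

End LinearMajorant.

(** * The complex surrogate and the two forms of a step *)
Section Complex.
Local Open Scope complex_scope.
Context {R : realType} {p k : nat}.
Context (Rm : 'M[R[i]]_(p, k) -> 'M[R[i]]_(p, k)).
Context (const : 'M[R]_(p, k) -> R) (lambda : R).
Implicit Types U V Y : 'M[R]_(p, k).

Definition ReR V : 'M[R]_(p, k) := map_mx (@complex.Re R) (Rm (to_complex V)).

Definition ImR V : 'M[R]_(p, k) := map_mx (@complex.Im R) (Rm (to_complex V)).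

Lemma surrogateE U V :
  surrogate Rm const U V = (const V - 2 * inner (ReR V) U)%:C.
Proof.
rewrite /surrogate addrC rmorphB /=; congr (_ + _).
rewrite -opprD; congr (- _).
rewrite innerE /mxtrace -big_split /= rmorphM /= exchange_big /= rmorph_sum /=.
rewrite mulr_sumr.
apply: eq_bigr => j _; rewrite !mxE -big_split /= rmorph_sum /= mulr_sumr.
apply: eq_bigr => i _; rewrite !mxE.
case: (Rm (to_complex V) i j) => a b; apply/eqP; rewrite eq_complex /=.
by apply/andP; split; apply/eqP; ring.
Qed.

(** Only the real part of R interacts with the real variable U. *)
Lemma frobeniusC_sub U V :
  frobeniusC (Rm (to_complex V) + lambda%:C *: to_complex V - to_complex U) =
  Num.sqrt (inner (ReR V + lambda *: V - U) (ReR V + lambda *: V - U)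
            + inner (ImR V) (ImR V)).
Proof.
rewrite /frobeniusC !innerE -big_split /=; congr Num.sqrt.
apply: eq_bigr => i _; rewrite -big_split /=; apply: eq_bigr => j _.
rewrite !mxE; case: (Rm (to_complex V) i j) => a b /=.
by rewrite sqr_sqrtr ?addr_ge0 ?sqr_ge0//; ring.
Qed.

Lemma ReR_entry V i j : `|ReR V i j| <= frobeniusC (Rm (to_complex V)).
Proof.
rewrite /frobeniusC -sqrtr_sqr ler_wsqrtr// (bigD1 i)//= (bigD1 j)//= !mxE -addrA.
case: (Rm (to_complex V) i j) => a b /=.
rewrite sqr_sqrtr ?addr_ge0 ?sqr_ge0// -addrA lerDl addr_ge0 ?sqr_ge0//.
by rewrite addr_ge0//; do ?[apply: sumr_ge0 => ? _]; exact: sqr_ge0.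
Qed.

Lemma mm_stepP V U : stiefel V ->
  mm_step Rm const lambda V U <-> mm_succ ReR lambda V U.
Proof.
move=> Vs; rewrite /mm_step /argmin /=.
have E Y : stiefel Y ->
    surrogate Rm const Y V + (lambda * frobenius (Y - V) ^+ 2)%:C =
    (const V + 2 * lambda * k%:R - 2 * inner (ReR V + lambda *: V) Y)%:C.
  move=> Ys; rewrite surrogateE -rmorphD/= frobenius_sqr; congr (_%:C).
  rewrite innerBr ![inner (Y - V) _]innerC !innerBr innerDl innerZl.
  by rewrite (innerC Y V) (stiefel_inner Ys) (stiefel_inner Vs); ring.
split=> [[Us Umin]|[_ Us Umax]]; split=> // Y Ys.
  by have := Umin Y Ys; rewrite !E// lecR; lra.
by have := Umax Y Ys; rewrite !E// lecR; lra.
Qed.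

Lemma projection_stepP V U : stiefel V ->
  projection_step Rm lambda V U <-> mm_succ ReR lambda V U.
Proof.
move=> Vs; rewrite /projection_step /argmin /=.
set A := ReR V + lambda *: V.
have ge0 Y : 0 <= inner (A - Y) (A - Y) + inner (ImR V) (ImR V).
  by rewrite -!frobenius_sqr addr_ge0 ?sqr_ge0.
have E Y : stiefel Y -> inner (A - Y) (A - Y) = inner A A - 2 * inner A Y + k%:R.
  move=> Ys; rewrite innerBr ![inner (A - Y) _]innerC !innerBr (innerC Y A).
  by rewrite (stiefel_inner Ys); ring.
split=> [[Us Umin]|[_ Us Umax]]; split=> // Y Ys.
  by have := Umin Y Ys; rewrite !frobeniusC_sub -/A ler_sqrt// !E//; lra.
by have := Umax Y Ys; rewrite !frobeniusC_sub -/A ler_sqrt// !E//; lra.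
Qed.

Lemma majorizes_linear (f : 'M[R]_(p, k) -> R) V U :
  majorizes f Rm const -> stiefel V -> stiefel U ->
  f U <= f V - 2 * inner (ReR V) (U - V).
Proof.
move=> maj Vs Us; have [eqV leU] := maj _ Vs.
have {leU} := leU _ Us; rewrite surrogateE lecR.
by move: eqV; rewrite surrogateE => -[<-]; rewrite innerBr; lra.
Qed.

Lemma mm_iterates_succ u : mm_iterates Rm const lambda u ->
  mm_sequence ReR lambda u.
Proof.
move=> [u0 step] n; apply/mm_stepP => //.
by case: n => // n; have [] := step n.
Qed.

End Complex.

Theorem corollary4p11 (R : realType) (p k : nat)
    (f : 'M[R]_(p, k) -> R)
    (Rm : 'M[R[i]]_(p, k) -> 'M[R[i]]_(p, k))
    (const : 'M[R]_(p, k) -> R) (lambda : R) :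
  stiefel_differentiable f ->
  majorizes f Rm const ->
  bounded_on_stiefel Rm ->
  0 <= lambda ->
  [/\ forall V, stiefel V ->
        mm_step Rm const lambda V = projection_step Rm lambda V,
      forall u, mm_iterates Rm const lambda u ->
        forall X, cluster (u @ \oo) X -> stationary f X
    & soft_bigO (iteration_complexity f Rm const lambda)
        (fun eps => eps ^- 2)].
Proof.
move=> fdiff maj [M0 leM0] lambda0; pose M := Num.max M0 0.
have M_ge0 : 0 <= M by rewrite le_max lexx orbT.
have leM V i j : stiefel V -> `|ReR Rm V i j| <= M.
  move=> Vs; apply: le_trans (ReR_entry _ _ _ _) _.
  by apply: le_trans (leM0 _ Vs) _; rewrite le_max lexx.
have majB V U : stiefel V -> stiefel U ->
    f U <= f V - 2 * inner (ReR Rm V) (U - V) by exact: majorizes_linear maj.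
split=> [V Vs|u /mm_iterates_succ Hu X|].
- apply/seteqP; split=> U.
    by move/(mm_stepP _ _ _ _ Vs)/(projection_stepP _ _ _ Vs).
  by move/(projection_stepP _ _ _ Vs)/(mm_stepP _ _ _ _ Vs).
- exact: (cluster_stationary fdiff majB leM lambda0 M_ge0 Hu).
pose c : R := @descent_cst R p k lambda M * (2 * (p%:R * k%:R * (M * 2))).
(* The exponent of the logarithm is 0, and the summand 1 absorbs the rounding up
   of c / e^2 to an integer, as 1 <= e^-2 for e <= 1. *)
exists 0%N, (c + 1); near=> e.
have e0 : 0 < e by near: e; exact: nbhs_right_gt.
have e1 : e <= 1 by near: e; exact: nbhs_right_ltW.
rewrite expr0 mulr1; apply: ge_ereal_sup => _ [u /mm_iterates_succ Hu <-].
apply: le_trans (complexity_bound fdiff majB leM lambda0 M_ge0 Hu e0) _.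
rewrite lee_fin -/c mulrDl lerD2l mul1r invf_ge1 ?exprn_gt0//.
by rewrite exprn_ile1// ltW.
Unshelve. all: by end_near. Qed.
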